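(* Let $F$ be the free commutative automorphic loop of nilpotency class two with free generators $x_1$, $x_2$, and let $z_1=(x_1,x_1,x_2)$, $z_2=(x_1,x_2,x_2)$ (associators). Then every element of $F$ can be written uniquely as $x_1^{a_1}x_2^{a_2}z_1^{a_3}z_2^{a_4}$ for some $a_1,a_2,a_3,a_4\in\mathbb Z$, and the multiplication in $F$ is given by $$(x_1^{a_1}x_2^{a_2}z_1^{a_3}z_2^{a_4})(x_1^{b_1}x_2^{b_2}z_1^{b_3}z_2^{b_4}) = x_1^{a_1+b_1}x_2^{a_2+b_2}z_1^{a_3+b_3-a_1b_1(a_2+b_2)}z_2^{a_4+b_4+a_2b_2(a_1+b_1)}.$$ Furthermore, $Z(F)=N_\lambda(F)=N_\mu(F)=N(F)=A(F)=\langle z_1,z_2\rangle\cong\mathbb Z^2$. The loop $F$ is the central extension of the free abelian group $\langle z_1,z_2\rangle$ by the free abelian group with free generators $x_1$, $x_2$ via the cocycle $$\theta(x_1^{a_1}x_2^{a_2},x_1^{b_1}x_2^{b_2}) = z_1^{-a_1b_1(a_2+b_2)}z_2^{a_2b_2(a_1+b_1)}.$$ Finally, the associator in $F$ is given by $$(x_1^{a_1}x_2^{a_2}z_1^{a_3}z_2^{a_4},\,x_1^{b_1}x_2^{b_2}z_1^{b_3}z_2^{b_4},\,x_1^{c_1}x_2^{c_2}z_1^{c_3}z_2^{c_4}) = z_1^{b_1(a_1c_2-a_2c_1)}z_2^{b_2(a_1c_2-a_2c_1)}.$$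
   Context: A loop is a set $Q$ with a binary operation and a neutral element $1$ such that for all $a,b\in Q$ the equations $ax=b$ and $ya=b$ have unique solutions $x,y\in Q$. With $L_x(y)=xy$, $R_x(y)=yx$, the inner mapping group $\mathrm{Inn}\,Q$ is generated by all $L_{yx}^{-1}L_yL_x$, $R_{xy}^{-1}R_yR_x$, $L_x^{-1}R_x$; $Q$ is automorphic if $\mathrm{Inn}\,Q\le\mathrm{Aut}\,Q$. Automorphic loops are power-associative, so powers $a^k$, $k\in\mathbb Z$, make sense. The associator $(x,y,z)$ is defined by $(xy)z=(x(yz))(x,y,z)$. The associator subloop $A(Q)$ is the smallest normal subloop $H$ such that $Q/H$ is a group. $N_\lambda(Q)=\{a: (ab)c=a(bc)\ \forall b,c\}$, $N_\mu(Q)=\{b: (ab)c=a(bc)\ \forall a,c\}$, $N_\rho(Q)=\{c:(ab)c=a(bc)\ \forall a,b\}$ are the left, middle and right nuclei, $N(Q)=N_\lambda(Q)\cap N_\mu(Q)\cap N_\rho(Q)$ is the nucleus, and the center $Z(Q)$ is the set of elements of $N(Q)$ commuting with all elements of $Q$. ''The free commutative automorphic loop of nilpotency class two'' means the free object in the variety of commutative automorphic loops $Q$ of nilpotency class at most two (i.e. $Q/Z(Q)$ is an abelian group). For an abelian group $Z$, a loop $L$ and a cocycle $\theta:L\times L\to Z$ (a map with $\theta(x,1)=\theta(1,x)=1$), the central extension of $Z$ by $L$ via $\theta$ is, up to isomorphism, the loop on $L\times Z$ with multiplication $(x_1,z_1)(x_2,z_2)=(x_1x_2,z_1z_2\theta(x_1,x_2))$.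 *)

(* Defs.v *)
From HB Require Import structures.
From mathcomp Require Import all_boot all_order all_algebra.
From mathcomp Require Import boolp classical_sets functions.

Set Implicit Arguments.
Unset Strict Implicit.
Unset Printing Implicit Defensive.

Local Open Scope classical_set_scope.
Local Open Scope group_scope.

HB.mixin Record UMagma_isLoop Q of UMagma Q := {
  lsolve : forall a b : Q, exists! x : Q, a * x = b;
  rsolve : forall a b : Q, exists! y : Q, y * a = b
}.

#[short(type="loopType")]
HB.structure Definition Loop := {Q of UMagma_isLoop Q & UMagma Q}.

Bind Scope group_scope with Loop.sort.

Section LoopTheory.
Variable Q : loopType.
Implicit Types (a b c x y z : Q) (A B C H : set Q).

Definition Ltrans x : Q -> Q := fun y => x * y.
Definition Rtrans x : Q -> Q := fun y => y * x.

(* Ldiv a b is the solution x of a * x = b, so that Ldiv a is the inverse of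
   Ltrans a; Rdiv a b is the solution y of y * a = b (usually written b / a),
   so that Rdiv a is the inverse of Rtrans a. *)
Definition Ldiv a b : Q := sval (cid (lsolve a b)).
Definition Rdiv a b : Q := sval (cid (rsolve a b)).

Lemma mulLdiv a b : a * Ldiv a b = b.
Proof. by rewrite /Ldiv; case: cid => x []. Qed.

Lemma mulRdiv a b : Rdiv a b * a = b.
Proof. by rewrite /Rdiv; case: cid => x []. Qed.

Lemma Ldiv_unique a b x : a * x = b -> x = Ldiv a b.
Proof. by rewrite /Ldiv; case: cid => y /= [_ +] => /[apply]. Qed.

Lemma Rdiv_unique a b y : y * a = b -> y = Rdiv a b.
Proof. by rewrite /Rdiv; case: cid => x /= [_ +] => /[apply]. Qed.

Lemma LtransK a : cancel (Ltrans a) (Ldiv a).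
Proof. by move=> b; apply/esym/Ldiv_unique. Qed.

Lemma LdivK a : cancel (Ldiv a) (Ltrans a).
Proof. exact: mulLdiv. Qed.

Lemma RtransK a : cancel (Rtrans a) (Rdiv a).
Proof. by move=> b; apply/esym/Rdiv_unique. Qed.

Lemma RdivK a : cancel (Rdiv a) (Rtrans a).
Proof. exact: mulRdiv. Qed.

(* Integer powers; the bracketing chosen here is immaterial in the
   power-associative loops they are used for. *)
Definition powz x (k : int) : Q :=
  match k with
  | Posz n => x ^+ n
  | Negz n => Ldiv x 1 ^+ n.+1
  end.

(* (xy)z = (x(yz)) (associator x y z) *)
Definition associator x y z : Q := Ldiv (x * (y * z)) (x * y * z).

Inductive inner_mapping : (Q -> Q) -> Prop :=
| inner_L x y : inner_mapping (Ldiv (y * x) \o Ltrans y \o Ltrans x)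
| inner_R x y : inner_mapping (Rdiv (x * y) \o Rtrans y \o Rtrans x)
| inner_T x : inner_mapping (Ldiv x \o Rtrans x)
| inner_id : inner_mapping id
| inner_comp f g : inner_mapping f -> inner_mapping g -> inner_mapping (f \o g)
| inner_inv f g :
    inner_mapping f -> cancel f g -> cancel g f -> inner_mapping g.

Definition automorphism (f : Q -> Q) : Prop :=
  bijective f /\ {morph f : x y / x * y}.

Definition subloop H : Prop :=
  [/\ H 1,
      forall x y, H x -> H y -> H (x * y),
      forall x y, H x -> H y -> H (Ldiv x y)
    & forall x y, H x -> H y -> H (Rdiv x y)].

Definition generated A : set Q := smallest subloop A.

Definition normal_subloop H : Prop :=
  subloop H /\ forall f, inner_mapping f -> f @` H = H.

Definition Lcoset H x : set Q := [set x * h | h in H].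

Definition setmul A B : set Q := [set a * b | a in A & b in B].

Definition quotient H : set (set Q) := [set Lcoset H x | x in setT].

(* For a normal subloop H, setmul (Lcoset H x) (Lcoset H y) = Lcoset H (x * y),
   and quotient H is a loop under setmul with neutral element H: it is a group
   as soon as setmul is associative on it. *)
Definition quotient_is_group H : Prop :=
  forall A B C, quotient H A -> quotient H B -> quotient H C ->
    setmul A (setmul B C) = setmul (setmul A B) C.

Definition quotient_is_abelian_group H : Prop :=
  quotient_is_group H /\
  forall A B, quotient H A -> quotient H B -> setmul A B = setmul B A.

(* H is the smallest normal subloop with a group quotient, i.e. H = A(Q). *)
Definition is_associator_subloop H : Prop :=
  [/\ normal_subloop H, quotient_is_group H
    & forall K, normal_subloop K -> quotient_is_group K -> H `<=` K].

Definition left_nucleus : set Q :=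
  [set a | forall b c, (a * b) * c = a * (b * c)].
Definition middle_nucleus : set Q :=
  [set b | forall a c, (a * b) * c = a * (b * c)].
Definition right_nucleus : set Q :=
  [set c | forall a b, (a * b) * c = a * (b * c)].
Definition nucleus : set Q := left_nucleus `&` middle_nucleus `&` right_nucleus.
Definition center : set Q := nucleus `&` [set a | forall b, a * b = b * a].

Lemma generated_subloop A : subloop (generated A).
Proof.
split=> [B [[H1 _ _ _] _]|x y Ax Ay B BH|x y Ax Ay B BH|x y Ax Ay B BH] //;
  case: (BH) => -[_ HM HL HR] _.
- by apply: HM; [apply: Ax | apply: Ay].
- by apply: HL; [apply: Ax | apply: Ay].
- by apply: HR; [apply: Ax | apply: Ay].
Qed.

End LoopTheory.

Arguments left_nucleus : clear implicits.
Arguments middle_nucleus : clear implicits.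
Arguments right_nucleus : clear implicits.
Arguments nucleus : clear implicits.
Arguments center : clear implicits.

Notation "x ^^ k" := (powz x k) (at level 30, right associativity) : group_scope.

Definition automorphic_loop (Q : loopType) : Prop :=
  forall f : Q -> Q, inner_mapping f -> automorphism f.

Definition nilpotency_class_le2 (Q : loopType) : Prop :=
  quotient_is_abelian_group (center Q).

Definition comm_automorphic_class2 (Q : loopType) : Prop :=
  [/\ commutative (@monoid.mul Q), automorphic_loop Q & nilpotency_class_le2 Q].

Definition abelian_group (Q : loopType) : Prop :=
  associative (@monoid.mul Q) /\ commutative (@monoid.mul Q).

(* F is free on x1, x2 in the class V of loops. A multiplicative map between
   loops automatically preserves 1 and both divisions. *)
Definition free_on (V : loopType -> Prop) (F : loopType) (x1 x2 : F) : Prop :=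
  V F /\
  forall Q : loopType, V Q -> forall q1 q2 : Q,
    exists! f : F -> Q, [/\ {morph f : x y / x * y}, f x1 = q1 & f x2 = q2].

Section SubloopType.
Variables (Q : loopType) (H : set Q) (hH : subloop H).

Definition subloop_type of subloop H : Type := set_type H.
Local Notation S := (subloop_type hH).

HB.instance Definition _ := Choice.on S.

Let mkS (x : Q) (Hx : H x) : S := SigSub (mem_set Hx).
Let S_in (u : S) : H (val u) := set_mem (valP u).
Let S_mem1 : H 1. Proof. by case: hH. Qed.
Let S_memM (u v : S) : H (val u * val v).
Proof. by case: hH => _ + _ _; apply. Qed.

Let S_mul (u v : S) : S := mkS (S_memM u v).
Let S_one : S := mkS S_mem1.

HB.instance Definition _ := hasMul.Build S S_mul.

Let S_mul1g : left_id S_one (@monoid.mul S).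
Proof. by move=> u; apply/val_inj; rewrite /= mul1g. Qed.
Let S_mulg1 : right_id S_one (@monoid.mul S).
Proof. by move=> u; apply/val_inj; rewrite /= mulg1. Qed.

HB.instance Definition _ := Magma_isUMagma.Build S S_mul1g S_mulg1.

Let S_lsolve (a b : S) : exists! x : S, a * x = b.
Proof.
have HD : H (Ldiv (val a) (val b)) by case: hH => _ _ + _; apply.
exists (mkS HD); split; first by apply/val_inj; rewrite /= mulLdiv.
by move=> x /(congr1 val) /= /Ldiv_unique e; apply/val_inj.
Qed.
Let S_rsolve (a b : S) : exists! y : S, y * a = b.
Proof.
have HD : H (Rdiv (val a) (val b)) by case: hH => _ _ _; apply.
exists (mkS HD); split; first by apply/val_inj; rewrite /= mulRdiv.
by move=> x /(congr1 val) /= /Rdiv_unique e; apply/val_inj.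
Qed.

HB.instance Definition _ := UMagma_isLoop.Build S S_lsolve S_rsolve.

Definition subloop_val (u : S) : Q := val u.

End SubloopType.

Definition cocycle (L Z : loopType) (theta : L -> L -> Z) : Prop :=
  forall x, theta x 1 = 1 /\ theta 1 x = 1.

Section CentralExtension.
Variables (L Z : loopType) (abZ : abelian_group Z).
Variables (theta : L -> L -> Z) (ctheta : cocycle theta).

Definition central_extension of abelian_group Z & cocycle theta : Type :=
  (L * Z)%type.
Local Notation E := (central_extension abZ ctheta).

HB.instance Definition _ := Choice.on E.

Let E_mul (u v : E) : E := (u.1 * v.1, u.2 * v.2 * theta u.1 v.1).

HB.instance Definition _ := hasMul.Build E E_mul.

Let E_mul1g : left_id (1, 1) (@monoid.mul E).
Proof.
by case=> x z; congr (_, _); rewrite /= ?mul1g // (ctheta x).2 mulg1.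
Qed.
Let E_mulg1 : right_id (1, 1) (@monoid.mul E).
Proof.
by case=> x z; congr (_, _); rewrite /= ?mulg1 // (ctheta x).1 mulg1.
Qed.

HB.instance Definition _ := Magma_isUMagma.Build E E_mul1g E_mulg1.

Let E_lsolve (a b : E) : exists! x : E, a * x = b.
Proof.
case: abZ => ZA ZC; case: a b => [x z] [y w]; pose t := Ldiv x y.
exists (t, Ldiv (z * theta x t) w); split.
  by congr (_, _); rewrite /= ?mulLdiv // -ZA (ZC _ (theta x _)) ZA mulLdiv.
case=> x' z' [ex]; have -> : x' = t by apply: Ldiv_unique.
by rewrite -ZA (ZC z') ZA => /Ldiv_unique ->.
Qed.
Let E_rsolve (a b : E) : exists! y : E, y * a = b.
Proof.
case: abZ => ZA ZC; case: a b => [x z] [y w]; pose t := Rdiv x y.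
exists (t, Ldiv (z * theta t x) w); split.
  congr (_, _); rewrite /= ?mulRdiv // (ZC _ z) -ZA (ZC _ (theta t x)) ZA.
  by rewrite mulLdiv.
case=> x' z' [ex]; have -> : x' = t by apply: Rdiv_unique.
by rewrite (ZC z') -ZA (ZC z') ZA => /Ldiv_unique ->.
Qed.

HB.instance Definition _ := UMagma_isLoop.Build E E_lsolve E_rsolve.

End CentralExtension.

(* Main.v *)
From HB Require Import structures.
Require Import Defs.
From mathcomp Require Import all_boot all_order all_algebra.
From mathcomp Require Import boolp classical_sets functions.
From mathcomp Require Import ring.

(** Let Q be a commutative automorphic loop all of whose associators are
central.  The mapping Ldiv (x * y) \o Ltrans x \o Ltrans y multiplies z by the
inverse of the associator of x, y, z, so its being an automorphism says exactly
that the associator is additive in z ([cassocMr]).  Commutativity makes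
such central associators antisymmetric under the exchange of their outer
arguments and gives them a Jacobi identity ([cassoc_sym], [cassoc_jacobi]);
together these force additivity in all three arguments.  Hence on two elements x, y every
associator is a combination of u = (x, x, y) and v = (x, y, y), with
coefficients read off by trilinearity ([cassoc_normal_form]).  The loop
generated by one element is a group, so powers behave, and rebracketing
(x^a y^b)(x^c y^d) into x^(a+c) y^(b+d) produces three associators, which
add up to the cocycle of the theorem ([mul_normal_form]).

This gives an upper bound on any two-generated loop of the class.  For the
lower bound, the same cocycle on pairs of integers defines a central extension
of Z^2 by Z^2, and this concrete loop is commutative, automorphic and of class
two ([model_class2]).  Evaluating exponents as a word is a homomorphism from
the model to the free loop F, by the product formula; freeness supplies a
homomorphism the other way, and comparing the two on generators
([free_retract]) shows that every element of F is a word in a unique way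
([word_bij]).

The rest is read off the coordinates: an element lies in the left or middle
nucleus iff its exponents of x1 and x2 vanish, and a normal subloop has a group
quotient iff it contains all associators ([quotient_is_groupP]), so any such
subloop contains the two generators of the center. *)

Set Implicit Arguments.
Unset Strict Implicit.
Unset Printing Implicit Defensive.

Import GRing.Theory.

Local Open Scope classical_set_scope.
Local Open Scope group_scope.

(** * General loops *)

Section Loops.
Variable Q : loopType.
Implicit Types (a b c x y z : Q) (H K : set Q).

Lemma lmul_inj a : injective (fun x => a * x).
Proof. exact: can_inj (@LtransK Q a). Qed.

Lemma lmul_bij a : bijective (fun x => a * x).
Proof. by exists (Ldiv a); [exact: LtransK | exact: LdivK]. Qed.

Lemma associatorE x y z : x * y * z = x * (y * z) * associator x y z.
Proof. by rewrite mulLdiv. Qed.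

Lemma associator_unique x y z c :
  x * y * z = x * (y * z) * c -> associator x y z = c.
Proof. by move=> e; apply/esym/Ldiv_unique. Qed.

Lemma subloop_pow H x k : subloop H -> H x -> H (x ^^ k).
Proof.
case=> H1 HM HL _ Hx.
have Hn y : H y -> forall n, H (y ^+ n).
  by move=> Hy; elim=> [|n IHn] //; rewrite expgS; apply: HM.
by case: k => n /=; apply: Hn => //; apply: HL.
Qed.

(** An additive invariant does not see the bracketing of a power. *)
Lemma morph_pow (V : zmodType) (g : Q -> V) x (k : int) :
  {morph g : s t / s * t >-> (s + t)%R} -> g (x ^^ k) = (g x *~ k)%R.
Proof.
move=> gM.
have g1 : g 1 = 0%R by apply: (addrI (g 1)); rewrite -gM mulg1 addr0.
have gn s n : g (s ^+ n) = (g s *+ n)%R.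
  by elim: n => // n IHn; rewrite expgS gM IHn mulrS.
case: k => n; first exact: gn.
rewrite NegzE mulrNz -mulNrn [LHS]gn; congr (_ *+ _)%R.
by apply/eqP; rewrite -addr_eq0 addrC -gM mulLdiv g1.
Qed.

(** For an element commuting with everything, left and middle nuclearity imply
right nuclearity; these two are put in a form where a stands in front, which
makes closure under products and inverses a matter of rewriting. *)
Lemma centerP a : center Q a <->
  (forall x, a * x = x * a) /\
  forall x y, a * (x * y) = a * x * y /\ a * (x * y) = x * (a * y).
Proof.
split=> [[[[aL aM] _] aC]|[aC aA]].
  split=> // x y; have aL' := aL x y; have aM' := aM x y.
  by split; rewrite -?aM' -aL' // aC.
have aL x y : a * x * y = a * (x * y) by rewrite (aA x y).1.
have aM x y : x * a * y = x * (a * y) by rewrite -(aA x y).2 -aC aL.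
split=> //; split=> [|x y]; first by split=> x y.
by rewrite -(aC (x * y)) -(aC y) (aA x y).2.
Qed.

Lemma center_subloop : subloop (center Q).
Proof.
have ZM a b : center Q a -> center Q b -> center Q (a * b).
  move=> /centerP[aC aA] /centerP[bC bA].
  have E y : a * b * y = a * (b * y) by rewrite (aA b y).1.
  apply/centerP; split=> [x|x y]; rewrite !E.
    by rewrite bC (aA x b).2.
  split; first by rewrite (bA x y).1 (aA _ y).1.
  by rewrite (bA x y).2 (aA x _).2.
have ZV a : center Q a -> center Q (Ldiv a 1).
  move=> /centerP[aC aA]; set i := Ldiv a 1.
  have ai : a * i = 1 by apply: mulLdiv.
  have aiK x : a * (i * x) = x by rewrite (aA i x).1 ai mul1g.
  apply/centerP; split=> [x|x y].
    by apply: (@lmul_inj a); rewrite aiK (aA x i).2 ai mulg1.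
  split; apply: (@lmul_inj a); rewrite aiK.
    by rewrite (aA _ y).1 aiK.
  by rewrite (aA x _).2 aiK.
split=> // [|a b Za Zb|a b Za Zb].
- by apply/centerP; split=> [x|x y]; rewrite ?mulg1 !mul1g.
- have -> : Ldiv a b = Ldiv a 1 * b.
    have /centerP[_ aA] := Za.
    by apply/esym/Ldiv_unique; rewrite (aA _ b).1 mulLdiv mul1g.
  by apply: ZM => //; apply: ZV.
- have -> : Rdiv a b = Ldiv a 1 * b.
    have /centerP[aC aA] := Za.
    by apply/esym/Rdiv_unique; rewrite -aC (aA _ b).1 mulLdiv mul1g.
  by apply: ZM => //; apply: ZV.
Qed.

End Loops.

(** * Normal subloops and quotients of commutative loops *)

Section CommutativeLoops.
Variables (Q : loopType) (mulC : commutative (@monoid.mul Q)).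
Implicit Types (a b c x y z : Q) (H K : set Q).

(** The generating inner mappings all express a failure of associativity or
commutativity, and a central argument causes none. *)
Lemma inner_center f c : inner_mapping f -> center Q c -> f c = c.
Proof.
move=> If /centerP[cC cA]; elim: If => //= {f}.
- move=> x y; apply/esym/Ldiv_unique.
  by rewrite /Ltrans -!cC -(cA y x).2.
- move=> x y; apply/esym/Rdiv_unique; rewrite /Rtrans.
  by rewrite (cA x y).1.
- by move=> x; apply/esym/Ldiv_unique; rewrite /Rtrans mulC.
- by move=> f g _ fc _ gc; rewrite gc.
- by move=> f g _ fc fK _; rewrite -{1}fc fK.
Qed.

Lemma center_normal : normal_subloop (center Q).
Proof.
split; first exact: center_subloop.
move=> f If; apply/seteqP; split=> [_ [c Zc <-]|c Zc] /=.
  by rewrite inner_center.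
by exists c => //; rewrite inner_center.
Qed.

Section Normal.
Variables (K : set Q) (nK : normal_subloop K).

Let K1 : K 1. Proof. by case: nK => -[]. Qed.

(** The mapping z |-> (x * y) \ (x * (y * z)) is inner and therefore permutes
K; [normal_shift] and [normal_unshift] are the two directions of this, and
they replace associativity in computations with cosets. *)
Lemma normal_shift x y k : K k -> exists2 h, K h & x * (y * k) = x * y * h.
Proof.
move=> Kk; pose f := Ldiv (x * y) \o Ltrans x \o Ltrans y.
exists (f k); last by rewrite /f /= mulLdiv.
by have /seteqP[+ _] := nK.2 f (inner_L _ _); apply; exists k.
Qed.

Lemma normal_unshift x y k : K k -> exists2 h, K h & x * y * k = x * (y * h).
Proof.
pose f := Ldiv (x * y) \o Ltrans x \o Ltrans y.
have /seteqP[_ +] := nK.2 f (inner_L _ _) => /[apply] -[h Kh <-].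
by exists h => //; rewrite /f /= mulLdiv.
Qed.

Lemma Lcoset_refl x : Lcoset K x x.
Proof. by exists 1 => //; rewrite mulg1. Qed.

Lemma LcosetM x k : K k -> Lcoset K (x * k) = Lcoset K x.
Proof.
move=> Kk; case: nK => -[_ KM KL _] _.
apply/seteqP; split=> _ [h Kh <-].
  have [h' Kh' ->] := normal_unshift x k Kh.
  by exists (k * h') => //; apply: KM.
have [h' Kh' e] := normal_shift x k (KL _ _ Kk Kh).
by exists h' => //; rewrite -e mulLdiv.
Qed.

Lemma setmul_Lcoset x y :
  setmul (Lcoset K x) (Lcoset K y) = Lcoset K (x * y).
Proof.
apply/seteqP; split=> [_ [_ [h Kh <-]] [_ [k Kk <-] <-]|_ [h Kh <-]].
  have [k' Kk' ->] := normal_shift (x * h) y Kk.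
  rewrite (mulC (x * h)); have [h' Kh' ->] := normal_shift y x Kh.
  by rewrite (mulC x) -(LcosetM _ Kh'); exists k'.
have [h' Kh' ->] := normal_unshift x y Kh.
exists x; first exact: Lcoset_refl.
by exists (y * h') => //; exists h'.
Qed.

(** Multiplication of cosets follows that of representatives, so the two
bracketings of a product of cosets are the cosets of x * (y * z) and of
x * y * z, which differ by the associator. *)
Lemma quotient_is_groupP :
  quotient_is_group K <-> forall x y z, K (associator x y z).
Proof.
split=> [gK x y z|KA _ _ _ [x _ <-] [y _ <-] [z _ <-]].
  have := gK _ _ _ (imageT (Lcoset K) x) (imageT (Lcoset K) y)
                   (imageT (Lcoset K) z).
  rewrite !setmul_Lcoset => e; have := Lcoset_refl (x * y * z).
  by rewrite -e => -[k Kk /esym/associator_unique ->].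
by rewrite !setmul_Lcoset (associatorE x y) (LcosetM _ (KA x y z)).
Qed.

End Normal.

Lemma nilpotency_class_le2P :
  nilpotency_class_le2 Q <-> forall x y z, center Q (associator x y z).
Proof.
split=> [[gZ _]|ZA]; first exact/(quotient_is_groupP center_normal).
split; first exact/(quotient_is_groupP center_normal).
move=> _ _ [x _ <-] [y _ <-].
by rewrite !(setmul_Lcoset center_normal) mulC.
Qed.

End CommutativeLoops.

(** * The center as an additive group *)

Section CenterGroup.
Variable Q : loopType.

(** The center is written additively so that integer combinations of
associators can be handled with the arithmetic of Z-modules. *)
Definition center_group : Type := set_type (center Q).
HB.instance Definition _ := Choice.on center_group.

Definition cval (u : center_group) : Q := val u.

Definition to_center (x : Q) (Zx : center Q x) : center_group :=
  SigSub (mem_set Zx).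

Let ZvalP (u : center_group) : center Q (val u) := set_mem (valP u).

Let addZ (u v : center_group) : center_group :=
  to_center (let: And4 _ M _ _ := center_subloop Q in
             M _ _ (ZvalP u) (ZvalP v)).
Let zeroZ : center_group :=
  to_center (let: And4 H1 _ _ _ := center_subloop Q in H1).
Let oppZ (u : center_group) : center_group :=
  to_center (let: And4 H1 _ L _ := center_subloop Q in
             L _ _ (ZvalP u) H1).

Let addZA : associative addZ.
Proof.
move=> u v w; apply/val_inj => /=.
by have /centerP[_ /(_ (val v) (val w))[]] := ZvalP u.
Qed.
Let addZC : commutative addZ.
Proof.
move=> u v; apply/val_inj => /=.
by have /centerP[-> _] := ZvalP u.
Qed.
Let add0Z : left_id zeroZ addZ.
Proof. by move=> u; apply/val_inj; rewrite /= mul1g. Qed.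
Let addNZ : left_inverse zeroZ oppZ addZ.
Proof. by move=> u; rewrite addZC; apply/val_inj; rewrite /= mulLdiv. Qed.

HB.instance Definition _ :=
  GRing.isZmodule.Build center_group addZA addZC add0Z addNZ.

Implicit Types (u v : center_group) (x y z : Q).

Lemma cval_in u : center Q (cval u). Proof. exact: ZvalP. Qed.

Lemma cval_inj : injective cval. Proof. exact: val_inj. Qed.

Lemma cvalD u v : cval (u + v)%R = cval u * cval v. Proof. by []. Qed.

Lemma cvalC u x : cval u * x = x * cval u.
Proof. by have /centerP[-> _] := cval_in u. Qed.

Lemma mul_cvalr u x y : x * (y * cval u) = x * y * cval u.
Proof.
by have /centerP[_ /(_ x y)[_]] := cval_in u; rewrite !cvalC => <-.
Qed.

Lemma mul_cvall u x y : x * cval u * y = x * y * cval u.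
Proof. by have /centerP[_ /(_ x y)[+ _]] := cval_in u; rewrite !cvalC. Qed.

Lemma mul_cvalD u v x : x * cval u * cval v = x * cval (u + v)%R.
Proof. by rewrite cvalD mul_cvalr. Qed.

Lemma mul_cval2 u v x y :
  (x * cval u) * (y * cval v) = x * y * cval (u + v)%R.
Proof. by rewrite mul_cvall mul_cvalr mul_cvalD addrC. Qed.

Lemma mul_cval_inj x u v : x * cval u = x * cval v -> u = v.
Proof. by move=> /lmul_inj /cval_inj. Qed.

Lemma mul_cvalK x u : x * cval u * cval (- u)%R = x.
Proof. by rewrite mul_cvalD subrr mulg1. Qed.

Lemma cval_pow u (k : int) : cval (u *~ k)%R = cval u ^^ k.
Proof.
have cvaln v n : cval (v *+ n)%R = cval v ^+ n.
  by elim: n => // n IHn; rewrite expgS -IHn -cvalD mulrS.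
case: k => n; first exact: cvaln.
by rewrite NegzE mulrNz -mulNrn cvaln.
Qed.

End CenterGroup.

(** * Associator calculus in class two *)

Section Class2.
Variables (Q : loopType) (hQ : comm_automorphic_class2 Q).
Implicit Types (x y z : Q) (u v : center_group Q).

Let mulC : commutative (@monoid.mul Q). Proof. by case: hQ. Qed.

Lemma associator_central x y z : center Q (associator x y z).
Proof. by move: x y z; apply/(nilpotency_class_le2P mulC); case: hQ. Qed.

Definition cassoc x y z : center_group Q :=
  to_center (associator_central x y z).

Lemma cval_cassoc x y z : cval (cassoc x y z) = associator x y z.
Proof. by []. Qed.

Lemma cassocE x y z : x * y * z = x * (y * z) * cval (cassoc x y z).
Proof. exact: associatorE. Qed.

Lemma cassoc_unique x y z u :
  x * y * z = x * (y * z) * cval u -> cassoc x y z = u.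
Proof. by rewrite cassocE => /mul_cval_inj. Qed.

Lemma cassocEr x y z : x * (y * z) = x * y * z * cval (- cassoc x y z)%R.
Proof. by rewrite (cassocE x) mul_cvalK. Qed.

(** The inner mapping f below is multiplication of s by a central
factor depending on s, namely the inverse of the associator of x, y, s; since f
is multiplicative, so is this factor. *)
Lemma cassocMr x y z t :
  cassoc x y (z * t) = (cassoc x y z + cassoc x y t)%R.
Proof.
pose f := Ldiv (x * y) \o Ltrans x \o Ltrans y.
have fE s : f s = s * cval (- cassoc x y s)%R.
  by apply/esym/Ldiv_unique; rewrite mul_cvalr -cassocEr.
have [_ /(_ _ (inner_L y x))[_ fM] _] := hQ.
apply: oppr_inj; apply: (@mul_cval_inj _ (z * t)).
by rewrite -fE [LHS](fM z t) -/f !fE mul_cval2 opprD.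
Qed.

Lemma cassoc_sym x y z : cassoc z y x = (- cassoc x y z)%R.
Proof.
apply: cassoc_unique.
by rewrite (mulC (z * y)) (mulC z) cassocEr (mulC _ z) (mulC y).
Qed.

Lemma cassoc_flexible x y : cassoc x y x = 0%R.
Proof. by apply: cassoc_unique; rewrite mulg1 mulC (mulC y). Qed.

(** Each cyclic rotation (st)r = (tr)s of a product of three elements costs
one associator, and three rotations return to the start. *)
Lemma cassoc_jacobi x y z :
  (cassoc x y z + cassoc y z x + cassoc z x y = 0)%R.
Proof.
apply: (@mul_cval_inj _ (x * y * z)); rewrite mulg1 -!mul_cvalD.
have rot s t r : s * t * r = t * r * s * cval (cassoc s t r).
  by rewrite cassocE (mulC s).
rewrite [RHS]rot (rot y z) (rot z x) !mul_cvalD; congr (_ * cval _).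
by rewrite [RHS]addrC [in RHS](addrC (cassoc y z x)) addrA.
Qed.

Lemma cassocMl x y z t :
  cassoc (x * t) y z = (cassoc x y z + cassoc t y z)%R.
Proof.
by rewrite cassoc_sym cassocMr opprD -!cassoc_sym.
Qed.

(** The Jacobi identity moves the middle argument to an outer position, where
additivity is known. *)
Lemma cassoc_middle x y z :
  cassoc x y z = (- cassoc y z x - cassoc z x y)%R.
Proof.
by apply/eqP; rewrite -opprD -addr_eq0 addrA cassoc_jacobi.
Qed.

Lemma cassocMm x y z t :
  cassoc x (y * t) z = (cassoc x y z + cassoc x t z)%R.
Proof.
rewrite !(cassoc_middle x) cassocMl cassocMr !opprD.
by rewrite addrACA.
Qed.

Lemma cassocXl x y z k : cassoc (x ^^ k) y z = (cassoc x y z *~ k)%R.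
Proof.
by apply: (morph_pow (g := fun s => cassoc s y z)) => s t; exact: cassocMl.
Qed.

Lemma cassocXm x y z k : cassoc x (y ^^ k) z = (cassoc x y z *~ k)%R.
Proof.
by apply: (morph_pow (g := fun s => cassoc x s z)) => s t; exact: cassocMm.
Qed.

Lemma cassocXr x y z k : cassoc x y (z ^^ k) = (cassoc x y z *~ k)%R.
Proof.
by apply: (morph_pow (g := fun s => cassoc x y s)) => s t; exact: cassocMr.
Qed.

Lemma mulA_cassoc0 x y z : cassoc x y z = 0%R -> x * (y * z) = x * y * z.
Proof. by move=> e; rewrite cassocE e mulg1. Qed.

(** By trilinearity every associator of powers of x is a multiple of (x, x, x),
which vanishes by [cassoc_flexible]; so powers of x associate. *)
Lemma powzS x (k : int) : x ^^ (1 + k)%R = x * x ^^ k.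
Proof.
case: k => n; first exact: expgS.
have -> : (1 + Negz n = - n%:Z)%R by rewrite NegzE -addn1 PoszD; ring.
have -> : x ^^ (- n%:Z)%R = Ldiv x 1 ^+ n.
  by case: n => // n.
rewrite /= expgS mulA_cassoc0 ?mulLdiv ?mul1g //.
have -> : Ldiv x 1 = x ^^ (-1)%R by [].
rewrite -[_ ^+ n]/((x ^^ (-1)%R) ^^ n%:Z) cassocXr cassocXm cassocXr.
by rewrite cassoc_flexible !mul0rz.
Qed.

Lemma powzD x (k l : int) : x ^^ (k + l)%R = x ^^ k * x ^^ l.
Proof.
have A0 (j : int) : cassoc x (x ^^ j) (x ^^ l) = 0%R.
  by rewrite cassocXr cassocXm cassoc_flexible !mul0rz.
have S (j : int) : x * (x ^^ j * x ^^ l) = x ^^ (1 + j)%R * x ^^ l.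
  by rewrite powzS mulA_cassoc0.
elim/int_ind: k => [|n IHn|n IHn]; first by rewrite add0r mul1g.
  by rewrite -add1n PoszD -addrA powzS IHn S.
apply: (@lmul_inj _ x); rewrite -powzS S -addn1 PoszD opprD !addrA.
have -> : (1 - n%:Z - 1 = - n%:Z)%R by ring.
exact: IHn.
Qed.

Section TwoGenerators.
Variables x y : Q.
Let u := cassoc x x y.
Let v := cassoc x y y.

Definition normal_form (a b : int) (t : center_group Q) : Q :=
  x ^^ a * y ^^ b * cval t.

(** Trilinear expansion: central factors contribute nothing, and among the
eight associators of x and y only (x, x, y), (x, y, y) and their reversals,
which carry the opposite sign, survive. *)
Lemma cassoc_normal_form (a1 a2 b1 b2 c1 c2 : int) r s t :
  cassoc (normal_form a1 a2 r) (normal_form b1 b2 s) (normal_form c1 c2 t) =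
  (u *~ (b1 * (a1 * c2 - a2 * c1)) + v *~ (b2 * (a1 * c2 - a2 * c1)))%R.
Proof.
have Cl w p q : cassoc (cval w) p q = 0%R.
  by apply: cassoc_unique; rewrite mulg1 !cvalC mul_cvall.
have Cm w p q : cassoc p (cval w) q = 0%R.
  by apply: cassoc_unique; rewrite mulg1 cvalC mul_cvall mul_cvalr.
have Cr w p q : cassoc p q (cval w) = 0%R.
  by apply: cassoc_unique; rewrite mulg1 mul_cvalr.
rewrite /normal_form !(cassocMl, cassocMm, cassocMr) !(Cl, Cm, Cr).
rewrite !(cassocXl, cassocXm, cassocXr) !cassoc_flexible.
rewrite (cassoc_sym x x y) (cassoc_sym x y y) -/u -/v.
rewrite !mul0rz !mulNrz !(addr0, add0r) -!mulrzA -!mulrNz.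
rewrite addrACA -!mulrzDr.
by congr (u *~ _ + v *~ _)%R; ring.
Qed.

(** The product is rebracketed as x^a1 (y^a2 (y^b2 x^b1)), then
(y^(a2+b2)) x^b1 is formed, commuted, and joined with x^a1; the three
associators met on the way make up the correction term. *)
Lemma mul_normal_form (a1 a2 b1 b2 : int) s t :
  normal_form a1 a2 s * normal_form b1 b2 t =
  normal_form (a1 + b1)%R (a2 + b2)%R
    (s + t + (u *~ (- (a1 * b1 * (a2 + b2))) +
              v *~ (a2 * b2 * (a1 + b1))))%R.
Proof.
rewrite /normal_form mul_cval2 (cassocE (x ^^ a1)).
rewrite (mulC (x ^^ b1)) (cassocEr (y ^^ a2)).
rewrite -powzD (mulC _ (x ^^ b1)) mul_cvalr cassocEr -powzD !mul_cvalD.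
congr (_ * cval _).
rewrite !(cassocXl, cassocXm, cassocXr, cassocMl, cassocMm, cassocMr).
rewrite !cassoc_flexible (cassoc_sym x y y) -/u -/v.
rewrite !mul0rz !mulNrz !(addr0, add0r) -!mulrzA -!mulrNz.
rewrite (addrA (v *~ _)%R) -mulrzDr addrA [LHS]addrC.
by congr (_ + (u *~ _ + v *~ _))%R; ring.
Qed.

End TwoGenerators.

End Class2.

(** * Homomorphisms and free loops *)

Lemma inj_surj_bij (S T : Type) (f : S -> T) :
  injective f -> (forall y, exists x, f x = y) -> bijective f.
Proof.
move=> f_inj f_surj; have fK y : f (sval (cid (f_surj y))) = y.
  by case: cid.
by exists (fun y => sval (cid (f_surj y))) => // x; apply: f_inj; rewrite fK.
Qed.

Section Morphisms.
Variables (P Q : loopType) (f : P -> Q) (fM : {morph f : x y / x * y}).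

Lemma loop_morph1 : f 1 = 1.
Proof. by apply: (@lmul_inj _ (f 1)); rewrite -fM !mulg1. Qed.

Lemma loop_morphLdiv x y : f (Ldiv x y) = Ldiv (f x) (f y).
Proof. by apply: Ldiv_unique; rewrite -fM mulLdiv. Qed.

Lemma loop_morphX x k : f (x ^^ k) = f x ^^ k.
Proof.
have fn y n : f (y ^+ n) = f y ^+ n.
  by elim: n => [|n IHn]; rewrite ?loop_morph1 // !expgS fM IHn.
by case: k => n /=; rewrite fn // loop_morphLdiv loop_morph1.
Qed.

Lemma loop_morph_associator x y z :
  f (associator x y z) = associator (f x) (f y) (f z).
Proof. by rewrite loop_morphLdiv !fM. Qed.

End Morphisms.

(** By the uniqueness part of freeness, g \o f is the identity of F, since it
fixes both generators.  So a homomorphism from any M in V that hits the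
generators is onto, and its section f gives coordinates of F in M. *)
Lemma free_retract (V : loopType -> Prop) (F : loopType) (x1 x2 : F)
    (M : loopType) (m1 m2 : M) (g : M -> F) :
    free_on V x1 x2 -> V M ->
    {morph g : x y / x * y} -> g m1 = x1 -> g m2 = x2 ->
  exists f : F -> M,
    [/\ {morph f : x y / x * y}, f x1 = m1, f x2 = m2 & cancel f g].
Proof.
move=> [VF free] VM gM g1 g2.
have [f [[fM f1 f2] _]] := free M VM m1 m2.
exists f; split=> // x; have [e [_ eU]] := free F VF x1 x2.
rewrite -[RHS]/(id x) -(eU id) // (eU (g \o f)) //.
by split=> [s t||] /=; rewrite ?fM ?gM ?f1 ?f2.
Qed.

(** In a commutative loop the middle inner mappings are trivial and the right
ones coincide with the left ones. *)
Lemma comm_automorphic (Q : loopType) :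
    commutative (@monoid.mul Q) ->
    (forall x y, {morph Ldiv (y * x) \o Ltrans y \o Ltrans x
                  : s t / s * t :> Q}) ->
  automorphic_loop Q.
Proof.
move=> mulC LM.
have RdivC (a b : Q) : Rdiv a b = Ldiv a b.
  by apply: Ldiv_unique; rewrite mulC mulRdiv.
have Laut (x y : Q) : automorphism (Ldiv (y * x) \o Ltrans y \o Ltrans x).
  split; last exact: LM.
  apply: bij_comp; last exact: lmul_bij.
  apply: bij_comp; last exact: lmul_bij.
  by exists (Ltrans (y * x)); [exact: LdivK | exact: LtransK].
move=> f; elim=> {f} //.
- move=> x y; have -> // : Rdiv (x * y) \o Rtrans y \o Rtrans x =
                           Ldiv (y * x) \o Ltrans y \o Ltrans x.
  apply/funext => s /=.
  by rewrite RdivC /Rtrans /Ltrans (mulC x y) (mulC s) (mulC (x * s)).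
- move=> x; have -> : Ldiv x \o Rtrans x = id.
    apply/funext => s /=.
    by apply/esym/Ldiv_unique; rewrite /Rtrans mulC.
  by split=> //; exists id.
- by split=> //; exists id.
- move=> f g _ [fb fM] _ [gb gM]; split; first exact: bij_comp.
  by move=> s t /=; rewrite gM fM.
- move=> f g _ [fb fM] fK gK; split; first by exists f.
  by move=> s t; rewrite -{1}(gK s) -{1}(gK t) -fM fK.
Qed.

Lemma abelian_group_class2 (Q : loopType) :
  abelian_group Q -> comm_automorphic_class2 Q.
Proof.
move=> [mulA mulC]; split=> //.
  apply: comm_automorphic => // x y s t.
  have LE r : (Ldiv (y * x) \o Ltrans y \o Ltrans x) r = r.
    by apply/esym/Ldiv_unique; rewrite -mulA.
  by rewrite !LE.
apply/(nilpotency_class_le2P mulC) => x y z.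
have -> : associator x y z = 1.
  by apply: associator_unique; rewrite mulg1 mulA.
by case: (center_subloop Q).
Qed.

(** * The integer model *)

Section ZmodLoop.
Variable V : zmodType.

(** A separate name for the carrier of V, so that the multiplicative structure
given to it does not affect V itself. *)
Definition zmod_loop : Type := V.
HB.instance Definition _ := Choice.on zmod_loop.
HB.instance Definition _ := hasMul.Build zmod_loop (@GRing.add V).
HB.instance Definition _ :=
  Magma_isUMagma.Build zmod_loop (@add0r V) (@addr0 V).

Let zmod_lsolve (a b : zmod_loop) : exists! x : zmod_loop, a * x = b.
Proof.
exists (b - a : V)%R; split=> [|x <-]; first exact: subrKC.
by rewrite /monoid.mul /= addrC addKr.
Qed.

Let zmod_rsolve (a b : zmod_loop) : exists! y : zmod_loop, y * a = b.
Proof.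
exists (b - a : V)%R; split=> [|x <-]; first exact: subrK.
exact: addrK.
Qed.

HB.instance Definition _ :=
  UMagma_isLoop.Build zmod_loop zmod_lsolve zmod_rsolve.

Lemma zmod_loop_abelian : abelian_group zmod_loop.
Proof. by split; [exact: addrA | exact: addrC]. Qed.

End ZmodLoop.

Section Model.
Local Open Scope ring_scope.

Definition Zsq_loop : loopType := zmod_loop (int * int)%type.

(** The correction term of [mul_normal_form], with (1, 0) and (0, 1) in the
roles of the associators u and v. *)
Definition model_cocycle (a b : Zsq_loop) : Zsq_loop :=
  (- (a.1 * b.1 * (a.2 + b.2)), a.2 * b.2 * (a.1 + b.1)).

Lemma model_cocycle_norm : cocycle model_cocycle.
Proof. by move=> [a b]; split; congr (_, _) => /=; ring. Qed.

Definition model : loopType :=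
  central_extension (zmod_loop_abelian (int * int)%type) model_cocycle_norm.

Definition quad (a1 a2 a3 a4 : int) : model := ((a1, a2), (a3, a4)).

Lemma quad_ind (P : model -> Prop) :
  (forall a1 a2 a3 a4, P (quad a1 a2 a3 a4)) -> forall m, P m.
Proof. by move=> PM [[a1 a2] [a3 a4]]; apply: PM. Qed.

Lemma quad1 : quad 0 0 0 0 = 1%g. Proof. by []. Qed.

Lemma quadM a1 a2 a3 a4 b1 b2 b3 b4 :
  (quad a1 a2 a3 a4 * quad b1 b2 b3 b4)%g =
  quad (a1 + b1) (a2 + b2) (a3 + b3 - a1 * b1 * (a2 + b2))
     (a4 + b4 + a2 * b2 * (a1 + b1)).
Proof. by []. Qed.

Lemma model_mulC : commutative (@monoid.mul model).
Proof.
elim/quad_ind => a1 a2 a3 a4; elim/quad_ind => b1 b2 b3 b4.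
by rewrite !quadM; congr quad; ring.
Qed.

Lemma associator_quad a1 a2 a3 a4 b1 b2 b3 b4 c1 c2 c3 c4 :
  associator (quad a1 a2 a3 a4) (quad b1 b2 b3 b4) (quad c1 c2 c3 c4) =
  quad 0 0 (b1 * (a1 * c2 - a2 * c1)) (b2 * (a1 * c2 - a2 * c1)).
Proof.
by apply: associator_unique; rewrite !quadM; congr quad; ring.
Qed.

(** The associator computed in [associator_quad] has central values and is
linear in the exponents of each argument, which is what class two and
automorphy amount to. *)
Lemma model_class2 : comm_automorphic_class2 model.
Proof.
split; first exact: model_mulC.
  apply: (comm_automorphic model_mulC); elim/quad_ind => a1 a2 a3 a4.
  elim/quad_ind => b1 b2 b3 b4; elim/quad_ind => c1 c2 c3 c4.
  elim/quad_ind => d1 d2 d3 d4.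
  have LE s1 s2 s3 s4 :
      (Ldiv (quad b1 b2 b3 b4 * quad a1 a2 a3 a4)%g \o Ltrans (quad b1 b2 b3 b4)
       \o Ltrans (quad a1 a2 a3 a4)) (quad s1 s2 s3 s4) =
      quad s1 s2 (s3 - a1 * (b1 * s2 - b2 * s1))
           (s4 - a2 * (b1 * s2 - b2 * s1)).
    by apply/esym/Ldiv_unique; rewrite /Ltrans !quadM; congr quad; ring.
  by rewrite (quadM c1) !LE quadM; congr quad; ring.
apply/(nilpotency_class_le2P model_mulC).
elim/quad_ind => a1 a2 a3 a4; elim/quad_ind => b1 b2 b3 b4.
elim/quad_ind => c1 c2 c3 c4; rewrite associator_quad.
apply/centerP; split=> [|]; elim/quad_ind => s1 s2 s3 s4.
  exact: model_mulC.
by elim/quad_ind => t1 t2 t3 t4; split; rewrite !quadM; congr quad; ring.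
Qed.

(** When one of the first two coordinates vanishes, so does the cocycle on
multiples of (a1, a2), and powers are computed coordinatewise. *)
Lemma quadX (a1 a2 a3 a4 k : int) :
  a1 = 0 \/ a2 = 0 ->
  (quad a1 a2 a3 a4 ^^ k)%g = quad (a1 * k) (a2 * k) (a3 * k) (a4 * k).
Proof.
have quadXn b1 b2 b3 b4 (n : nat) : b1 = 0 \/ b2 = 0 ->
    (quad b1 b2 b3 b4 ^+ n)%g =
    quad (b1 * n%:Z) (b2 * n%:Z) (b3 * n%:Z) (b4 * n%:Z).
  move=> b0; elim: n => [|n IHn]; first by rewrite !mulr0.
  by rewrite expgS IHn quadM -add1n PoszD; case: b0 => ->; congr quad; ring.
case: k => n a0; first exact: quadXn.
rewrite /powz.
have <- : quad (- a1) (- a2) (- a3) (- a4) = Ldiv (quad a1 a2 a3 a4) 1%g.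
  by apply: Ldiv_unique; rewrite quadM -quad1; case: a0 => ->; congr quad; ring.
rewrite quadXn ?NegzE; last by case: a0 => ->; [left|right].
by congr quad; ring.
Qed.

End Model.

(** * The free loop on two generators *)

Section FreeLoop.
Variables (F : loopType) (x1 x2 : F).
Hypothesis freeF : free_on comm_automorphic_class2 x1 x2.

Let VF : comm_automorphic_class2 F := freeF.1.
Let z1 := associator x1 x1 x2.
Let z2 := associator x1 x2 x2.
Let u1 : center_group F := cassoc VF x1 x1 x2.
Let u2 : center_group F := cassoc VF x1 x2 x2.

Definition word (a1 a2 a3 a4 : int) : F :=
  x1 ^^ a1 * x2 ^^ a2 * z1 ^^ a3 * z2 ^^ a4.

Lemma wordE a1 a2 a3 a4 :
  word a1 a2 a3 a4 = normal_form x1 x2 a1 a2 (u1 *~ a3 + u2 *~ a4)%R.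
Proof. by rewrite /normal_form -mul_cvalD !cval_pow. Qed.

Lemma word_mul (a1 a2 a3 a4 b1 b2 b3 b4 : int) :
  word a1 a2 a3 a4 * word b1 b2 b3 b4 =
  word (a1 + b1)%R (a2 + b2)%R
    (a3 + b3 - a1 * b1 * (a2 + b2))%R (a4 + b4 + a2 * b2 * (a1 + b1))%R.
Proof.
rewrite !wordE (mul_normal_form VF) -/u1 -/u2; congr normal_form.
by rewrite !mulrzDr (addrACA (u1 *~ a3)%R) [LHS]addrACA.
Qed.

Lemma word_associator (a1 a2 a3 a4 b1 b2 b3 b4 c1 c2 c3 c4 : int) :
  associator (word a1 a2 a3 a4) (word b1 b2 b3 b4) (word c1 c2 c3 c4) =
  z1 ^^ (b1 * (a1 * c2 - a2 * c1))%R * z2 ^^ (b2 * (a1 * c2 - a2 * c1))%R.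
Proof.
rewrite !wordE -(cval_cassoc VF) cassoc_normal_form.
by rewrite cvalD !cval_pow.
Qed.

(** The exponents are recovered by the homomorphism f to the integer model,
a section of the homomorphism g that evaluates quadruples as words. *)
Lemma word_bij u : exists! a : int * int * int * int,
  let: (a1, a2, a3, a4) := a in u = word a1 a2 a3 a4.
Proof.
pose g (m : model) := word m.1.1 m.1.2 m.2.1 m.2.2.
have gM : {morph g : s t / s * t}.
  elim/quad_ind=> a1 a2 a3 a4; elim/quad_ind=> b1 b2 b3 b4.
  by rewrite quadM /g /= word_mul.
have g1 : g (quad 1 0 0 0) = x1 by rewrite /g /word /= !mulg1.
have g2 : g (quad 0 1 0 0) = x2 by rewrite /g /word /= !mulg1 mul1g.
have [f [fM f1 f2 fK]] := free_retract freeF model_class2 gM g1 g2.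
have fword a1 a2 a3 a4 : f (word a1 a2 a3 a4) = quad a1 a2 a3 a4.
  rewrite /word !fM !(loop_morphX fM) !(loop_morph_associator fM) f1 f2.
  rewrite !associator_quad !quadX; [|by left|by left|by left|by right].
  by rewrite !quadM; congr quad; ring.
exists ((f u).1.1, (f u).1.2, (f u).2.1, (f u).2.2).
split; first by rewrite -[LHS]fK.
by move=> [[[a1 a2] a3] a4] ->; rewrite fword.
Qed.

Lemma word_surj u : exists a1 a2 a3 a4, u = word a1 a2 a3 a4.
Proof.
by have [[[[a1 a2] a3] a4] [-> _]] := word_bij u; exists a1, a2, a3, a4.
Qed.

Lemma word_inj a1 a2 a3 a4 b1 b2 b3 b4 :
  word a1 a2 a3 a4 = word b1 b2 b3 b4 -> (a1, a2, a3, a4) = (b1, b2, b3, b4).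
Proof.
move=> e; have [c [_ cU]] := word_bij (word a1 a2 a3 a4).
by rewrite -(cU (a1, a2, a3, a4)) // -(cU (b1, b2, b3, b4)).
Qed.

Lemma word0 a b : word 0 0 a b = z1 ^^ a * z2 ^^ b.
Proof. by rewrite /word !mul1g. Qed.

Lemma word1 : word 0 0 0 0 = 1.
Proof. by rewrite word0 mulg1. Qed.

Lemma word_split a1 a2 a3 a4 :
  word a1 a2 a3 a4 = x1 ^^ a1 * x2 ^^ a2 * word 0 0 a3 a4.
Proof. by rewrite !wordE /normal_form !mul1g. Qed.

Let Zsub : set F := generated [set z1; z2].
Let Zloop : loopType := subloop_type (generated_subloop [set z1; z2]).

Lemma generated_word0 a b : Zsub (word 0 0 a b).
Proof.
have ZsubG := generated_subloop [set z1; z2]; rewrite word0.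
have Zz z : [set z1; z2] z -> Zsub z by move=> Az B [_]; apply.
case: (ZsubG) => _ ZM _ _.
by apply: ZM; apply: (subloop_pow _ ZsubG); apply: Zz; [left|right].
Qed.

Lemma Zsub_center : Zsub `<=` center F.
Proof.
move=> z; apply; split; first exact: center_subloop.
by move=> _ [->|->]; apply: associator_central.
Qed.

(** Testing x against (x1, c) makes the associator a power of z1 alone, with
exponent a1 c2 - a2 c1; c = x2 and c = x1 then kill a1 and a2. *)
Lemma left_nucleus_word0 x :
  left_nucleus F x -> exists a b, x = word 0 0 a b.
Proof.
have [a1 [a2 [a3 [a4 ->]]]] := word_surj x => Nx; exists a3, a4.
have A c1 c2 : word 0 0 (a1 * c2 - a2 * c1)%R 0 = word 0 0 0 0.
  have := word_associator a1 a2 a3 a4 1 0 0 0 c1 c2 0 0.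
  rewrite (associator_unique (c := 1)) ?mulg1 // mul1r mul0r.
  by rewrite -word0 => <-; rewrite word1.
have [e1] := word_inj (A 0%R 1%R); have [e2] := word_inj (A 1%R 0%R).
have -> : a1 = 0%R by rewrite -e1; ring.
by have -> : a2 = 0%R by apply: oppr_inj; rewrite oppr0 -e2; ring.
Qed.

(** The associator of x1, x, x2 is z1^b1 z2^b2. *)
Lemma middle_nucleus_word0 x :
  middle_nucleus F x -> exists a b, x = word 0 0 a b.
Proof.
have [b1 [b2 [b3 [b4 ->]]]] := word_surj x => Nx; exists b3, b4.
have := word_associator 1 0 0 0 b1 b2 b3 b4 0 1 0 0.
rewrite (associator_unique (c := 1)) ?mulg1 // -word0 -{1}word1.
by move=> /word_inj[]; rewrite !mul0r subr0 !mulr1 => <- <-.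
Qed.

Lemma nuclei_eq :
  [/\ center F = left_nucleus F, left_nucleus F = middle_nucleus F,
      middle_nucleus F = nucleus F & nucleus F = Zsub].
Proof.
have ZN : center F `<=` nucleus F by move=> x [].
have Nl : nucleus F `<=` left_nucleus F by move=> x [[]].
have Nm : nucleus F `<=` middle_nucleus F by move=> x [[]].
have lE : left_nucleus F = Zsub.
  apply/seteqP; split.
    by move=> x /left_nucleus_word0[a [b ->]]; exact: generated_word0.
  by move=> x /Zsub_center/ZN/Nl.
have mE : middle_nucleus F = Zsub.
  apply/seteqP; split.
    by move=> x /middle_nucleus_word0[a [b ->]]; exact: generated_word0.
  by move=> x /Zsub_center/ZN/Nm.
have nE : nucleus F = Zsub.
  apply/seteqP; split; first by rewrite -lE.
  by move=> x /Zsub_center/ZN.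
rewrite lE mE nE; split=> //; apply/seteqP; split; last exact: Zsub_center.
by rewrite -nE.
Qed.

Lemma Zsub_associator_subloop : is_associator_subloop Zsub.
Proof.
have [mulC _ _] := VF; have [ZE lE mE nE] := nuclei_eq.
have {}ZE : Zsub = center F by rewrite -nE -mE -lE.
rewrite ZE; split; first exact: center_normal.
  apply/(quotient_is_groupP mulC (center_normal mulC)) => x y z.
  exact: associator_central.
move=> K nK /(quotient_is_groupP mulC nK) KA; rewrite -ZE => z; apply.
by split; [case: nK | move=> _ [->|->]; exact: KA].
Qed.

Definition zpair (p : int * int) : Zloop :=
  SigSub (mem_set (generated_word0 p.1 p.2)).

Lemma zpair_pow p : subloop_val (zpair p) = z1 ^^ p.1 * z2 ^^ p.2.
Proof. exact: word0. Qed.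

Lemma zpair_word p : subloop_val (zpair p) = word 0 0 p.1 p.2.
Proof. by []. Qed.

Lemma subloop_val_inj : injective (fun z : Zloop => subloop_val z).
Proof. exact: val_inj. Qed.

Lemma zpairD p q : zpair (p + q)%R = zpair p * zpair q.
Proof.
apply: subloop_val_inj; rewrite [RHS]word_mul zpair_word.
by congr word => /=; ring.
Qed.

Lemma zpair_surj (z : Zloop) : exists p, zpair p = z.
Proof.
have : left_nucleus F (subloop_val z).
  have [<- _ _ _] := nuclei_eq; exact/Zsub_center/set_mem/(valP z).
move=> /left_nucleus_word0[a [b e]].
by exists (a, b); apply: subloop_val_inj; rewrite zpair_word e.
Qed.

Lemma zpair_inj : injective zpair.
Proof.
move=> [a b] [c d] /(congr1 (fun z => subloop_val z)).
by rewrite !zpair_word => /word_inj[-> ->].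
Qed.

Lemma zpair_bij : bijective zpair.
Proof. exact: inj_surj_bij zpair_inj zpair_surj. Qed.

Lemma Zloop_abelian : abelian_group Zloop.
Proof.
split=> [s t r|s t]; have [p <-] := zpair_surj s; have [q <-] := zpair_surj t.
  by have [o <-] := zpair_surj r; rewrite -!zpairD addrA.
by rewrite -!zpairD addrC.
Qed.

Section Extension.
Variables (L : loopType) (y1 y2 : L).
Hypothesis freeL : free_on abelian_group y1 y2.

(** The free abelian loop is compared with Z^2 by the same retract argument
as F with its model.  That the coordinates of y1^a y2^b are a and b follows from
the projections of Z^2 being additive. *)
Lemma free_abelian_coordinates : exists f : L -> Zsq_loop,
  [/\ {morph f : s t / s * t}, bijective f
    & forall a b : int, f (y1 ^^ a * y2 ^^ b) = (a, b)].
Proof.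
have [[mulA mulC] _] := freeL; have VL := abelian_group_class2 freeL.1.
pose g (p : Zsq_loop) := y1 ^^ p.1 * y2 ^^ p.2.
have gM : {morph g : p q / p * q}.
  move=> p q; rewrite /g !(powzD VL) -!mulA; congr (_ * _).
  by rewrite !mulA (mulC (_ ^^ _)).
have g1 : g ((1, 0) : int * int)%R = y1 by rewrite /g /= mulg1.
have g2 : g ((0, 1) : int * int)%R = y2 by rewrite /g /= mul1g.
have [f [fM f1 f2 fK]] :=
  free_retract freeL (zmod_loop_abelian (int * int)%type) gM g1 g2.
have fg (a b : int) : f (y1 ^^ a * y2 ^^ b) = (a, b).
  rewrite fM !(loop_morphX fM) f1 f2.
  have X1 (p : Zsq_loop) k : (p ^^ k).1 = (p.1 *~ k)%R.
    by apply: (@morph_pow Zsq_loop int (fun p => p.1)).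
  have X2 (p : Zsq_loop) k : (p ^^ k).2 = (p.2 *~ k)%R.
    by apply: (@morph_pow Zsq_loop int (fun p => p.2)).
  rewrite [LHS]surjective_pairing; congr (_, _).
    by rewrite [LHS](congr2 +%R (X1 _ _) (X1 _ _)) /= mul0rz intz addr0.
  by rewrite [LHS](congr2 +%R (X2 _ _) (X2 _ _)) /= mul0rz intz add0r.
exists f; split=> //; exists g => // p; rewrite /g fg.
by case: p.
Qed.

(** L is coordinatized by f, so the pair of s in L and z in the center
corresponds to the word with exponents f s, multiplied by z. *)
Lemma free_central_extension :
  exists (abZ : abelian_group Zloop)
         (theta : L -> L -> Zloop) (ctheta : cocycle theta),
    (forall a1 a2 b1 b2 : int,
       subloop_val (theta (y1 ^^ a1 * y2 ^^ a2) (y1 ^^ b1 * y2 ^^ b2)) =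
       z1 ^^ (- (a1 * b1 * (a2 + b2)))%R * z2 ^^ (a2 * b2 * (a1 + b1))%R) /\
    exists phi : central_extension abZ ctheta -> F,
      [/\ bijective phi,
          {morph phi : u v / u * v},
          forall z : Zloop, phi (1, z) = subloop_val z,
          phi (y1, 1) = x1
        & phi (y2, 1) = x2].
Proof.
have [f [fM [g fK gK] fE]] := free_abelian_coordinates.
pose theta s t := zpair (model_cocycle (f s) (f t)).
have f1 : f 1 = 1 := loop_morph1 fM.
have z0 : zpair 0%R = 1.
  by apply: subloop_val_inj; rewrite zpair_pow; exact: mulg1.
have ctheta : cocycle theta.
  move=> s; have [r1 l1] := model_cocycle_norm (f s).
  by rewrite /theta f1 r1 l1.
exists Zloop_abelian, theta, ctheta.
split=> [a1 a2 b1 b2|]; first by rewrite /theta !fE zpair_pow.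
pose phi (m : central_extension Zloop_abelian ctheta) : F :=
  x1 ^^ (f m.1).1 * x2 ^^ (f m.1).2 * subloop_val m.2.
have phiE s p : phi (s, zpair p) = word (f s).1 (f s).2 p.1 p.2.
  by rewrite /phi zpair_word -word_split.
have phi_f s z :
  phi (s, z) = x1 ^^ (f s).1 * x2 ^^ (f s).2 * subloop_val z by [].
exists phi; split.
- apply: inj_surj_bij => [[s z] [t z']|x].
    have [p <-] := zpair_surj z; have [q <-] := zpair_surj z'.
    rewrite !phiE => /word_inj[e1 e2 e3 e4]; congr (_, zpair _).
      apply: (can_inj fK).
      by rewrite [LHS]surjective_pairing e1 e2 -surjective_pairing.
    by rewrite [LHS]surjective_pairing e3 e4 -surjective_pairing.
  have [a1 [a2 [a3 [a4 ->]]]] := word_surj x.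
  by exists (g (a1, a2), zpair (a3, a4)); rewrite phiE gK.
- move=> [s z] [t z'].
  have [p <-] := zpair_surj z; have [q <-] := zpair_surj z'.
  rewrite [LHS](_ : _ =
    phi (s * t, zpair (p + q + model_cocycle (f s) (f t))%R)).
    by rewrite !phiE fM word_mul; congr word.
  by rewrite !zpairD.
- by move=> z; rewrite phi_f f1 /= !mul1g.
- (* y1 has coordinates (1, 0), being the word y1^1 y2^0. *)
  rewrite phi_f -[y1](mulg1 y1) -{2}[1]/(y2 ^^ 0) -[y1]/(y1 ^^ 1) fE /=.
  by rewrite !mulg1.
- (* Likewise y2 is the word y1^0 y2^1. *)
  rewrite phi_f -[y2](mul1g y2) -{2}[1]/(y1 ^^ 0) -[y2]/(y2 ^^ 1) fE /=.
  by rewrite mulg1 mul1g.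
Qed.
End Extension.
End FreeLoop.

Theorem theorem2p3 (F : loopType) (x1 x2 : F)
    (freeF : free_on comm_automorphic_class2 x1 x2) :
  let z1 := associator x1 x1 x2 in
  let z2 := associator x1 x2 x2 in
  let w (a1 a2 a3 a4 : int) : F :=
    x1 ^^ a1 * x2 ^^ a2 * z1 ^^ a3 * z2 ^^ a4 in
  let Zsub : set F := generated [set z1; z2] in
  let Zloop : loopType := subloop_type (generated_subloop [set z1; z2]) in
  (forall u : F, exists! a : int * int * int * int,
     let: (a1, a2, a3, a4) := a in u = w a1 a2 a3 a4) /\
  (forall a1 a2 a3 a4 b1 b2 b3 b4 : int,
     w a1 a2 a3 a4 * w b1 b2 b3 b4 =
     w (a1 + b1)%R (a2 + b2)%R
       (a3 + b3 - a1 * b1 * (a2 + b2))%R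
       (a4 + b4 + a2 * b2 * (a1 + b1))%R) /\
  [/\ center F = left_nucleus F,
      left_nucleus F = middle_nucleus F,
      middle_nucleus F = nucleus F,
      nucleus F = Zsub
    & is_associator_subloop Zsub] /\
  (exists f : int * int -> Zloop,
     bijective f /\ forall u v, f (u + v)%R = f u * f v) /\
  (forall (L : loopType) (y1 y2 : L), free_on abelian_group y1 y2 ->
     exists (abZ : abelian_group Zloop)
            (theta : L -> L -> Zloop) (ctheta : cocycle theta),
       (forall a1 a2 b1 b2 : int,
          subloop_val (theta (y1 ^^ a1 * y2 ^^ a2) (y1 ^^ b1 * y2 ^^ b2)) =
          z1 ^^ (- (a1 * b1 * (a2 + b2)))%R * z2 ^^ (a2 * b2 * (a1 + b1))%R) /\
       exists phi : central_extension abZ ctheta -> F,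
         [/\ bijective phi,
             {morph phi : u v / u * v},
             forall z : Zloop, phi (1, z) = subloop_val z,
             phi (y1, 1) = x1
           & phi (y2, 1) = x2]) /\
  (forall a1 a2 a3 a4 b1 b2 b3 b4 c1 c2 c3 c4 : int,
     associator (w a1 a2 a3 a4) (w b1 b2 b3 b4) (w c1 c2 c3 c4) =
     z1 ^^ (b1 * (a1 * c2 - a2 * c1))%R * z2 ^^ (b2 * (a1 * c2 - a2 * c1))%R).
Proof.
move=> z1 z2 w Zsub Zloop.
split; first exact: word_bij.
split; first exact: word_mul.
split.
  have [ZE lE mE nE] := nuclei_eq freeF; split=> //.
  exact: Zsub_associator_subloop.
split; first by exists (zpair x1 x2); split; [exact: zpair_bij | exact: zpairD].
split; first exact: free_central_extension.
exact: word_associator.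
Qed.
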